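(* Let $R$ be a right p.p.-ring and let $M$ be a strictly totally ordered monoid. If $R$ is $M$-central Armendariz, then $R$ is $M$-Armendariz.
   Context: All rings are associative with identity. $C(R)$ denotes the center of a ring $R$, and $R[M]$ denotes the monoid ring of a monoid $M$ over $R$. Consider $\alpha=a_1g_1+\dots+a_mg_m\in R[M]$ and $\beta=b_1h_1+\dots+b_nh_n\in R[M]$ with $a_i,b_j\in R$, $g_1,\dots,g_m\in M$ pairwise distinct, and $h_1,\dots,h_n\in M$ pairwise distinct. The ring $R$ is called $M$-Armendariz if for all such $\alpha,\beta$, $\alpha\beta=0$ implies $a_ib_j=0$ for all $i,j$. The ring $R$ is called $M$-central Armendariz if for all such $\alpha,\beta$, $\alpha\beta=0$ implies $a_ib_j\in C(R)$ for all $i,j$. A ring $R$ is a right p.p.-ring (right principal projective) if the right annihilator of each element of $R$ is generated, as a right ideal, by an idempotent, i.e. for each $a\in R$ there is an idempotent $f\in R$ with $\{r\in R: ar=0\}=fR$. An ordered monoid $(M,\le)$ is strictly ordered if for all $g,g',h\in M$, $g<g'$ implies $gh<g'h$ and $hg<hg'$. It is strictly totally ordered if in addition $\le$ is a total order. *)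

(* Defs.v *)
From HB Require Import structures.
From mathcomp Require Import all_boot all_order all_algebra.
From mathcomp Require Import finmap.
From mathcomp Require Import monalg.

Set Implicit Arguments.
Unset Strict Implicit.
Unset Printing Implicit Defensive.

Import GRing.Theory.

Local Open Scope fset_scope.
Local Open Scope ring_scope.

(** Compatibility of [<=] with the product follows from the strict laws. *)

HB.mixin Record isStrictlyOrdered (d : Order.disp_t) M
    of monoid.Monoid M & Order.POrder d M := {
  ltMr : forall g g' h : M, (g < g')%O -> ((g * h)%g < (g' * h)%g)%O;
  ltMl : forall g g' h : M, (g < g')%O -> ((h * g)%g < (h * g')%g)%O
}.

#[short(type="strictOrderedMonoidType")]
HB.structure Definition StrictOrderedMonoid d :=
  { M of monoid.Monoid M & Order.POrder d M & isStrictlyOrdered d M }.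

#[short(type="strictTotalOrderedMonoidType")]
HB.structure Definition StrictTotalOrderedMonoid d :=
  { M of StrictOrderedMonoid d M & Order.Total d M }.

(** The monoid ring [R[M]].  [monalg] makes [{malg R[M]}] a ring only when [R]
    is non-trivial and [x * y = 1] implies [x = y = 1] in [M], which excludes
    groups.  The alias [monoidRing] carries the same convolution product
    without these restrictions. *)

Definition monoidRing (R : pzRingType) (M : monoidType) : Type := {malg R[M]}.

HB.instance Definition _ R M := GRing.Zmodule.copy (monoidRing R M) {malg R[M]}.

Section MonoidRing.
Context (R : pzRingType) (M : monoidType).
Implicit Types (x y z : {malg R[M]}).

Definition mrone : {malg R[M]} := << 1 *g 1%g >>.

Definition mrmul x y : {malg R[M]} :=
  \sum_(g <- msupp x) \sum_(h <- msupp y) << x@_g * y@_h *g (g * h)%g >>.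

Lemma mrmulw (D E : {fset M}) x y : msupp x `<=` D -> msupp y `<=` E ->
  mrmul x y = \sum_(g <- D) \sum_(h <- E) << x@_g * y@_h *g (g * h)%g >>.
Proof.
move=> leD leE; rewrite /mrmul (big_fset_incl _ leD) /=.
  apply/eq_bigr=> g _; apply/big_fset_incl => // h _ /mcoeff_outdom ->.
  by rewrite mulr0 monalgU0.
move=> g _ /mcoeff_outdom xg.
by rewrite big1 // => h _; rewrite xg mul0r monalgU0.
Qed.

Lemma mrmulUU a b g h :
  mrmul << a *g g >> << b *g h >> = << a * b *g (g * h)%g >>.
Proof. by rewrite (mrmulw msuppU_le msuppU_le) !big_seq_fset1 !mcoeffUU. Qed.

Lemma mrmulDl : left_distributive mrmul +%R.
Proof.
move=> x y z; set D := msupp x `|` msupp y.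
have sxD : msupp x `<=` D by apply: fsubsetUl.
have syD : msupp y `<=` D by apply: fsubsetUr.
rewrite (mrmulw sxD (fsubset_refl _)) (mrmulw syD (fsubset_refl _)).
rewrite (mrmulw (msuppD_le x y) (fsubset_refl _)) -big_split /=.
apply/eq_bigr=> g _; rewrite -big_split /=; apply/eq_bigr=> h _.
by rewrite mcoeffD mulrDl monalgUD.
Qed.

Lemma mrmulDr : right_distributive mrmul +%R.
Proof.
move=> x y z; set D := msupp y `|` msupp z.
have syD : msupp y `<=` D by apply: fsubsetUl.
have szD : msupp z `<=` D by apply: fsubsetUr.
rewrite (mrmulw (fsubset_refl _) syD) (mrmulw (fsubset_refl _) szD).
rewrite (mrmulw (fsubset_refl _) (msuppD_le y z)) -big_split /=.
apply/eq_bigr=> g _; rewrite -big_split /=; apply/eq_bigr=> h _.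
by rewrite mcoeffD mulrDr monalgUD.
Qed.

Lemma mrmul0x : left_zero 0 mrmul.
Proof. by move=> x; rewrite /mrmul msupp0 big_seq_fset0. Qed.

Lemma mrmulx0 : right_zero 0 mrmul.
Proof.
by move=> x; rewrite /mrmul big1 // => g _; rewrite msupp0 big_seq_fset0.
Qed.

Lemma mrmul_suml I (r : seq I) (F : I -> {malg R[M]}) y :
  mrmul (\sum_(i <- r) F i) y = \sum_(i <- r) mrmul (F i) y.
Proof.
exact: (big_morph (mrmul^~ y) (fun _ _ => mrmulDl _ _ _) (mrmul0x y)).
Qed.

Lemma mrmul_sumr I (r : seq I) (F : I -> {malg R[M]}) x :
  mrmul x (\sum_(i <- r) F i) = \sum_(i <- r) mrmul x (F i).
Proof.
exact: (big_morph (mrmul x) (fun _ _ => mrmulDr _ _ _) (mrmulx0 x)).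
Qed.

Lemma mrmulA : associative mrmul.
Proof.
move=> x y z; rewrite [x]monalgE mrmul_suml [in RHS]mrmul_suml mrmul_suml.
apply/eq_bigr=> g _; rewrite [y]monalgE mrmul_suml !mrmul_sumr mrmul_suml.
apply/eq_bigr=> h _; rewrite [z]monalgE !mrmul_sumr.
by apply/eq_bigr=> k _; rewrite !mrmulUU mulrA mulgA.
Qed.

Lemma mrmul1x : left_id mrone mrmul.
Proof.
move=> x; rewrite {1}[x]monalgE mrmul_sumr [RHS]monalgE.
by apply/eq_bigr=> g _; rewrite mrmulUU mul1r mul1g.
Qed.

Lemma mrmulx1 : right_id mrone mrmul.
Proof.
move=> x; rewrite {1}[x]monalgE mrmul_suml [RHS]monalgE.
by apply/eq_bigr=> g _; rewrite mrmulUU mulr1 mulg1.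
Qed.

HB.instance Definition _ := GRing.Zmodule_isPzRing.Build (monoidRing R M)
  mrmulA mrmul1x mrmulx1 mrmulDl mrmulDr.

Definition mrterm (a : R) (g : M) : monoidRing R M := << a *g g >>.

End MonoidRing.

Section Armendariz.
Context (R : pzRingType).

Definition ring_center (z : R) : Prop := forall x : R, GRing.comm z x.

Definition right_pp : Prop :=
  forall a : R, exists f : R,
    f * f = f /\ (forall r : R, a * r = 0 <-> exists s : R, r = f * s).

Definition armendariz (M : monoidType) : Prop :=
  forall (m n : nat) (a : 'I_m -> R) (g : 'I_m -> M)
         (b : 'I_n -> R) (h : 'I_n -> M),
    injective g -> injective h ->
    (\sum_(i < m) mrterm (a i) (g i)) * (\sum_(j < n) mrterm (b j) (h j)) = 0 ->
    forall (i : 'I_m) (j : 'I_n), a i * b j = 0.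

Definition central_armendariz (M : monoidType) : Prop :=
  forall (m n : nat) (a : 'I_m -> R) (g : 'I_m -> M)
         (b : 'I_n -> R) (h : 'I_n -> M),
    injective g -> injective h ->
    (\sum_(i < m) mrterm (a i) (g i)) * (\sum_(j < n) mrterm (b j) (h j)) = 0 ->
    forall (i : 'I_m) (j : 'I_n), ring_center (a i * b j).

End Armendariz.

(* Main.v *)
Require Import Defs.
From mathcomp Require Import all_boot all_order all_algebra.
From mathcomp Require Import monalg.

Import Order.TTheory GRing.Theory.

Local Open Scope ring_scope.

(** As soon as [M] has an element [x <> 1], the hypotheses force [R] to be
    reduced, and reduced rings are Armendariz over strictly totally ordered
    monoids.

    Centrality is tested on a product of two binomials in [1] and [x] that
    vanishes for every idempotent [e] and every [r], and in which [e r (1 - e)]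
    is a product of coefficients ([central_armendariz_corner]).  This element is
    thus central; it commutes with [e], which fixes it on the left and kills it
    on the right, so it is zero.  Hence idempotents are central.  If
    [r r = 0], then [r] lies in its own right annihilator [f R], with [f]
    a central idempotent, so [r = f r = r f = 0]
    ([central_armendariz_reduced]).

    Over a reduced ring, suppose [alpha beta = 0] and some [a_i b_j <> 0], with
    [g_i] minimal and then [h_j] minimal.  In the coefficient of [alpha beta] at
    [g_i h_j], a term [a_k b_l] with [g_k < g_i] is zero by minimality; every
    other term has [h_l < h_j] by strictness of the order, so [a_i b_l = 0] by
    minimality and [b_l a_i = 0] because [(b_l a_i)^2 = 0].  Multiplying by
    [a_i] on the right leaves [a_i b_j a_i = 0], so [(a_i b_j)^2 = 0] and
    [a_i b_j = 0], a contradiction ([reduced_armendariz]).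

    If no [g_i] or [h_j] differs from [1], then, these being pairwise distinct,
    [alpha] and [beta] have one term each and [alpha beta = 0] is the equation
    [a_i b_j = 0]. *)

Lemma mrtermM (R : pzRingType) (M : monoidType) (a b : R) (g h : M) :
  mrterm a g * mrterm b h = mrterm (a * b) (g * h)%g.
Proof. exact: mrmulUU. Qed.

Lemma mrtermD (R : pzRingType) (M : monoidType) (a b : R) (g : M) :
  mrterm (a + b) g = mrterm a g + mrterm b g.
Proof. exact: monalgUD. Qed.

Lemma mrterm0 (R : pzRingType) (M : monoidType) (g : M) :
  mrterm (0 : R) g = 0.
Proof. exact: monalgU0. Qed.

Lemma mrmul_eq0_coeff (R : pzRingType) (M : monoidType) (m n : nat)
    (a : 'I_m -> R) (g : 'I_m -> M) (b : 'I_n -> R) (h : 'I_n -> M) (w : M) :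
  (\sum_(i < m) mrterm (a i) (g i)) * (\sum_(j < n) mrterm (b j) (h j)) = 0 ->
  \sum_(p : 'I_m * 'I_n | (g p.1 * h p.2)%g == w) a p.1 * b p.2 = 0.
Proof.
move=> ab0; rewrite -[RHS](@mcoeff0 M R w) -[in RHS]ab0 mulr_suml.
under [in RHS]eq_bigr => i _ do rewrite mulr_sumr.
rewrite pair_big /= (raddf_sum (mcoeff w)) big_mkcond /=.
by apply: eq_bigr => p _; rewrite mrtermM mcoeffU; case: eqP.
Qed.

(** With [c = e r (1 - e)] one has [e c = c] and [c e = c c = 0], so
    [(e - c x) ((1 - e) + c x) = 0]: the terms [e c x] and [- c (1 - e) x]
    cancel, and the others vanish.  Hence [e c = c] commutes with [e], and
    [c = e c = c e = 0]. *)
Lemma central_armendariz_corner (R : pzRingType) (M : monoidType) (x : M) :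
  x != 1%g -> central_armendariz R M ->
  forall e r : R, e * e = e -> e * r * (1 - e) = 0.
Proof.
move=> x1 cR e r ee; set c := e * r * (1 - e).
have ec : e * c = c by rewrite /c !mulrA ee.
have ce : c * e = 0 by rewrite /c -mulrA mulrBl mul1r ee subrr mulr0.
have cc : c * c = 0 by rewrite -{2}ec mulrA ce mul0r.
pose a (i : 'I_2) := if i == 0 then e else - c.
pose b (i : 'I_2) := if i == 0 then 1 - e else c.
pose g (i : 'I_2) := if i == 0 then 1%g else x.
have g_inj : injective g.
  move=> i j; rewrite /g; case: (altP (i =P 0)) (altP (j =P 0)).
    by move=> -> [->//|_ /eqP]; rewrite eq_sym (negPf x1).
  move=> i0 [_ /eqP|j0 _]; first by rewrite (negPf x1).
  by apply/val_inj; case: i j i0 j0 => [[|[|?]] ?] [[|[|?]] ?].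
have ab0 : (\sum_i mrterm (a i) (g i)) * (\sum_j mrterm (b j) (g j)) = 0.
  rewrite !big_ord_recl !big_ord0 /a /b /g /= !addr0 mulrDl !mulrDr !mrtermM.
  rewrite mul1g mul1g mulg1 mulNr mulrBr mulr1 ee subrr mrterm0 add0r mulNr cc.
  rewrite oppr0 mrterm0 addr0 -mrtermD ec.
  by rewrite mulrBr mulr1 ce subr0 subrr mrterm0.
have /(_ e) := cR 2 2 a g b g g_inj g_inj ab0 0 1.
by rewrite /GRing.comm /a /b /= ec ec ce.
Qed.

(** The vanishing of the corners of [e] and of [1 - e] reads [e r = e r e] and
    [r e = e r e]. *)
Lemma central_armendariz_idem_central (R : pzRingType) (M : monoidType)
    (x : M) :
  x != 1%g -> central_armendariz R M ->
  forall e : R, e * e = e -> ring_center e.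
Proof.
move=> x1 cR e ee r.
have e'e' : (1 - e) * (1 - e) = 1 - e.
  by rewrite mulrBr mulr1 mulrBl mul1r ee subrr subr0.
have /eqP := @central_armendariz_corner _ _ _ x1 cR e r ee.
have /eqP := @central_armendariz_corner _ _ _ x1 cR _ r e'e'.
rewrite subKr mulrBl mul1r mulrBl subr_eq0 => /eqP re.
by rewrite mulrBr mulr1 subr_eq0 => /eqP er; rewrite /GRing.comm er re.
Qed.

Lemma central_armendariz_reduced (R : pzRingType) (M : monoidType) (x : M) :
  x != 1%g -> right_pp R -> central_armendariz R M ->
  forall r : R, r * r = 0 -> r = 0.
Proof.
move=> x1 ppR cR r rr; have [f [ff annr]] := ppR r.
have [s rE] := (annr r).1 rr.
have rf : r * f = 0 by apply/annr; exists f.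
have fr : f * r = r by rewrite rE mulrA ff.
by rewrite -fr (@central_armendariz_idem_central _ _ _ x1 cR f ff r).
Qed.

(** Used in contrapositive form: among the distinct pairs with a given product,
    a larger left factor goes with a smaller right factor. *)
Lemma mulg_le_inj {d : Order.disp_t} {M : strictOrderedMonoidType d}
    {g g' h h' : M} :
  (g <= g')%O -> (h <= h')%O -> (g * h = g' * h')%g -> g = g' /\ h = h'.
Proof.
rewrite !le_eqVlt => /predU1P[<-|gg'] /predU1P[<-|hh'] // E.
- by have := ltMl _ _ g hh'; rewrite E ltxx.
- by have := ltMr _ _ h gg'; rewrite E ltxx.
- by have := lt_trans (ltMr _ _ h gg') (ltMl _ _ g' hh'); rewrite E ltxx.
Qed.

Lemma reduced_armendariz (R : pzRingType) (d : Order.disp_t)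
    (M : strictTotalOrderedMonoidType d) :
  (forall r : R, r * r = 0 -> r = 0) -> armendariz R M.
Proof.
move=> redR m n a g b h g_inj h_inj ab0 i0 j0.
apply/eqP/negPn/negP => nz0.
have Pi0 : [exists j, a i0 * b j != 0] by apply/existsP; exists j0.
(* A counterexample [(i, j)] with [g i] minimal and then [h j] minimal. *)
case: (arg_minP (P := fun k => [exists j, a k * b j != 0]) g Pi0) =>
  i /existsP[j1 nz1] min_i.
case: (arg_minP (P := fun l => a i * b l != 0) h nz1) => j nz min_j.
have lt_g k l : (g k < g i)%O -> a k * b l = 0.
  rewrite ltNge => gki; apply/eqP/negPn/negP => nzkl.
  by case/negP: gki; apply: min_i; apply/existsP; exists l.
have lt_h l : (h l < h j)%O -> b l * a i = 0.
  rewrite ltNge => hlj; have abl : a i * b l = 0.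
    by apply/eqP/negPn/negP => nzl; case/negP: hlj; apply: min_j.
  by apply: redR; rewrite -mulrA (mulrA (a i)) abl mul0r mulr0.
(* Right multiplication by [a i] kills the terms [a k * b l] with [b l * a i = 0]
   and turns the term of [(i, j)] into [a i * b j * a i]. *)
have /(congr1 (fun z => z * a i)) :=
  @mrmul_eq0_coeff _ _ _ _ a g b h (g i * h j)%g ab0.
rewrite mul0r mulr_suml (bigD1 (i, j)) //= big1 =>
  [aba|[k l] /= /andP[/eqP gh ne]].
  case/eqP: nz; apply: redR.
  by move: aba; rewrite addr0 mulrA => ->; rewrite mul0r.
have [gki|gik] := ltP (g k) (g i); first by rewrite lt_g ?mul0r.
suff hlj : (h l < h j)%O by rewrite -mulrA lt_h ?mulr0.
rewrite ltNge; apply/negP => hjl; case/eqP: ne.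
have [eg eh] := mulg_le_inj gik hjl (esym gh).
by rewrite (g_inj _ _ eg) (h_inj _ _ eh).
Qed.

Theorem theorem2p8 (R : pzRingType) (d : Order.disp_t)
    (M : strictTotalOrderedMonoidType d) :
  right_pp R -> central_armendariz R M -> armendariz R M.
Proof.
move=> ppR cR m n a g b h g_inj h_inj ab0 i j.
have arm (x : M) : x != 1%g -> a i * b j = 0.
  move=> nt; have redR := @central_armendariz_reduced _ _ _ nt ppR cR.
  exact: (@reduced_armendariz _ _ _ redR _ _ _ _ _ _ g_inj h_inj ab0).
have [/existsP[k /arm //]|g1] := boolP [exists k, g k != 1%g].
have [/existsP[l /arm //]|h1] := boolP [exists l, h l != 1%g].
have gE k : g k = 1%g by apply/eqP; move: g1 => /existsPn/(_ k)/negPn.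
have hE l : h l = 1%g by apply/eqP; move: h1 => /existsPn/(_ l)/negPn.
(* By injectivity [(i, j)] is the only pair of indices, so the coefficient of
   the product at [1] is the single term [a i * b j]. *)
rewrite -[RHS](@mrmul_eq0_coeff _ _ _ _ a g b h 1%g ab0).
rewrite (bigD1 (i, j)) /= ?gE ?hE ?mulg1 // big1 ?addr0 // => -[k l] /andP[_].
by case/eqP; congr (_, _); [apply: g_inj|apply: h_inj]; rewrite ?gE ?hE.
Qed.
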